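(* The inverse Anderson-Rubin test confidence sets describe quadrics in $\mathbb{R}^{m_x}$. Precisely: let $S:=\begin{pmatrix}X&W\end{pmatrix}$ and let $B\in\mathbb{R}^{m_x\times m}$ have ones on the diagonal and zeros elsewhere, such that $SB^T=X$. Let $F_{\chi^2(k-m_w)}$ be the cumulative distribution function of a $\chi^2(k-m_w)$ random variable and let $$\hat\beta_{\mathrm{k}}(\kappa):=\left(S^T(\mathrm{Id}_n-\kappa M_Z)S\right)^\dagger S^T(\mathrm{Id}_n-\kappa M_Z)y$$ ($\dagger$ the Moore–Penrose pseudoinverse) be the k-class estimator for $(\beta_0^T,\gamma_0^T)^T$ using covariates $S$, instruments $Z$ and outcome $y$. Define $$\kappa_{\mathrm{AR}}(\alpha):=1+F^{-1}_{\chi^2(k-m_w)}(1-\alpha)/(n-k),\qquad \hat\sigma^2(\kappa):=\tfrac1{n-k}\|M_Z(y-S\hat\beta_{\mathrm{k}}(\kappa))\|^2,$$ $$A(\kappa):=\left(B\left(S^T(\mathrm{Id}_n-\kappa M_Z)S\right)^{-1}B^T\right)^{-1}=X^T(\mathrm{Id}_n-\kappa M_Z)X-X^T(\mathrm{Id}_n-\kappa M_Z)W\left(W^T(\mathrm{Id}_n-\kappa M_Z)W\right)^{-1}W^T(\mathrm{Id}_n-\kappa M_Z)X.$$ If $m_w>0$, let $\kappa_{\max}:=\lambda_{\min}\left((W^TM_ZW)^{-1}W^TP_ZW\right)+1$, where $\lambda_{\min}$ denotes the minimal eigenvalue of a matrix; else $\kappa_{\max}:=\infty$. If $\kappa_{\mathrm{AR}}(\alpha)\leq\kappa_{\max}$,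 then $$\mathrm{CI}_{\mathrm{AR}}(1-\alpha)=\Big\{\beta\in\mathbb{R}^{m_x}\ \Big|\ \left(\beta-B\hat\beta_{\mathrm{k}}(\kappa_{\mathrm{AR}}(\alpha))\right)^TA(\kappa_{\mathrm{AR}}(\alpha))\left(\beta-B\hat\beta_{\mathrm{k}}(\kappa_{\mathrm{AR}}(\alpha))\right)\leq\hat\sigma^2(\kappa_{\mathrm{AR}}(\alpha))\cdot\left(F^{-1}_{\chi^2(k-m_w)}(1-\alpha)-k\,\mathrm{AR}(\hat\beta_{\mathrm{k}}(\kappa_{\mathrm{AR}}(\alpha)))\right)\Big\}.$$ Else, $\mathrm{CI}_{\mathrm{AR}}(1-\alpha)=\mathbb{R}^{m_x}$.
   Context: Data: $y\in\mathbb{R}^n$ (outcomes), $X\in\mathbb{R}^{n\times m_x}$ (endogenous covariates of interest), $W\in\mathbb{R}^{n\times m_w}$ (endogenous covariates not of interest), $Z\in\mathbb{R}^{n\times k}$ (instruments), with $m:=m_x+m_w\leq k<n$; they are generated by a linear instrumental variables model $y=X\beta_0+W\gamma_0+\varepsilon$. For a matrix $A$, $P_A:=A(A^TA)^\dagger A^T$ and $M_A:=\mathrm{Id}-P_A$. The level $\alpha\in(0,1]$. Subvector Anderson-Rubin test statistic: for $\beta\in\mathbb{R}^{m_x}$, $$\mathrm{AR}(\beta):=\min_{\gamma\in\mathbb{R}^{m_w}}\frac{n-k}{k-m_w}\frac{(y-X\beta-W\gamma)^TP_Z(y-X\beta-W\gamma)}{(y-X\beta-W\gamma)^TM_Z(y-X\beta-W\gamma)}.$$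 Confidence set: $\mathrm{CI}_{\mathrm{AR}}(1-\alpha):=\{\beta\in\mathbb{R}^{m_x}\mid(k-m_w)\,\mathrm{AR}(\beta)\leq F^{-1}_{\chi^2(k-m_w)}(1-\alpha)\}$. For a full vector $b\in\mathbb{R}^m$, $\mathrm{AR}(b)$ denotes the (non-subvector) statistic for the covariates $S$, i.e. $k\,\mathrm{AR}(b)=(n-k)\frac{(y-Sb)^TP_Z(y-Sb)}{(y-Sb)^TM_Z(y-Sb)}$. If $m_w=0$, terms involving $W$ are absent. Matrices written with an inverse are implicitly taken to be invertible, and denominators to be nonzero. *)

(* Defs.v *)
From HB Require Import structures.
From mathcomp Require Import all_boot all_order all_algebra.
From mathcomp Require Import all_classical all_reals all_analysis.

Set Implicit Arguments.
Unset Strict Implicit.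
Unset Printing Implicit Defensive.

Import Order.TTheory GRing.Theory Num.Theory.

Local Open Scope classical_set_scope.
Local Open Scope ring_scope.

Section PseudoInverse.
Context {R : realType}.

Definition moore_penrose p q (A : 'M[R]_(p, q)) (G : 'M[R]_(q, p)) : Prop :=
  [/\ A *m G *m A = A,
      G *m A *m G = G,
      (A *m G)^T = A *m G &
      (G *m A)^T = G *m A].

(* The default value 0 is never used, see pinvP. *)
Definition pinv p q (A : 'M[R]_(p, q)) : 'M[R]_(q, p) :=
  xget 0 [set G | moore_penrose A G].

Lemma gram_eq0 p q (A : 'M[R]_(p, q)) : A^T *m A = 0 -> A = 0.
Proof.
move=> AA0; apply/matrixP => i j; rewrite mxE.
have /matrixP /(_ j j) := AA0; rewrite !mxE => /eqP.
under eq_bigr do rewrite mxE -expr2.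
rewrite psumr_eq0; last by move=> a _; exact: sqr_ge0.
by move=> /allP /(_ i (mem_index_enum i)) /=; rewrite sqrf_eq0 => /eqP.
Qed.

Lemma gram_unit p q (A : 'M[R]_(p, q)) :
  row_free A -> A *m A^T \in unitmx.
Proof.
move=> fA; rewrite -row_free_unit; apply/inj_row_free => v vAA0.
apply: (row_free_inj fA); rewrite mul0mx.
apply: trmx_inj; rewrite trmx0; apply: gram_eq0.
by rewrite trmxK trmx_mul mulmxA -(mulmxA v) vAA0 mul0mx.
Qed.

Lemma moore_penrose_factor p q r (C : 'M[R]_(p, r)) (B : 'M[R]_(r, q)) :
  C^T *m C \in unitmx -> B *m B^T \in unitmx ->
  moore_penrose (C *m B)
    (B^T *m invmx (B *m B^T) *m invmx (C^T *m C) *m C^T).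
Proof.
move=> uC uB; set V := invmx (B *m B^T); set U := invmx (C^T *m C).
have VT : V^T = V by rewrite trmx_inv trmx_mul trmxK.
have UT : U^T = U by rewrite trmx_inv trmx_mul trmxK.
set A := C *m B; set G := B^T *m V *m U *m C^T.
have BV : B *m (B^T *m V) = 1%:M by rewrite mulmxA mulmxV.
have UC : U *m (C^T *m C) = 1%:M by rewrite mulVmx.
have AG : A *m G = C *m (U *m C^T).
  rewrite /A /G -(mulmxA C) -(mulmxA _ U) (mulmxA B) BV mul1mx.
  by [].
have GA : G *m A = B^T *m (V *m B).
  rewrite /A /G -(mulmxA (B^T *m V *m U)) (mulmxA C^T) -(mulmxA (B^T *m V)).
  by rewrite (mulmxA U) UC mul1mx -mulmxA.
split.
- by rewrite AG /A -mulmxA (mulmxA (U *m C^T)) -(mulmxA U) UC mul1mx.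
- rewrite GA /G -(mulmxA (B^T *m V) U) (mulmxA B^T V B).
  by rewrite -(mulmxA (B^T *m V) B) (mulmxA B) BV mul1mx.
- by rewrite AG !trmx_mul trmxK UT mulmxA.
- by rewrite GA !trmx_mul trmxK VT mulmxA.
Qed.

Lemma moore_penrose_exists p q (A : 'M[R]_(p, q)) :
  exists G, moore_penrose A G.
Proof.
have := @moore_penrose_factor _ _ _ (col_base A) (row_base A).
rewrite mulmx_base => mpA; eexists; apply: mpA.
  rewrite -{2}[col_base A]trmxK; apply: gram_unit.
  by rewrite /row_free mxrank_tr; exact: col_base_full.
by apply: gram_unit; exact: row_base_free.
Qed.

Lemma pinvP p q (A : 'M[R]_(p, q)) : moore_penrose A (pinv A).
Proof.
exact: (@xgetPex _ 0 [set G | moore_penrose A G] (moore_penrose_exists A)).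
Qed.

Lemma moore_penrose_uniq p q (A : 'M[R]_(p, q)) (G H : 'M[R]_(q, p)) :
  moore_penrose A G -> moore_penrose A H -> G = H.
Proof.
move=> [AGA GAG AG GA] [AHA HAH AH HA].
have e1 : A *m G = A *m H.
  have AHG : A *m H *m (A *m G) = A *m G by rewrite mulmxA AHA.
  by rewrite -AG -AHG trmx_mul AG AH mulmxA AGA.
have e2 : G *m A = H *m A.
  have GHA : G *m A *m (H *m A) = G *m A by rewrite -mulmxA (mulmxA A) AHA.
  by rewrite -GA -GHA trmx_mul GA HA -mulmxA (mulmxA A) AGA.
by rewrite -GAG e2 -mulmxA e1 mulmxA HAH.
Qed.

End PseudoInverse.

Section Chi2.
Context {R : realType}.

Definition Gamma (s : R) : R :=
  \int[lebesgue_measure]_(t in `]0, +oo[) (t `^ (s - 1) * expR (- t)).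

Definition chi2_pdf (d : nat) (x : R) : R :=
  if 0 < x then
    x `^ (d%:R / 2 - 1) * expR (- x / 2) / (2 `^ (d%:R / 2) * Gamma (d%:R / 2))
  else 0.

Definition chi2_cdf (d : nat) (x : R) : R :=
  \int[lebesgue_measure]_(t in `]-oo, x]) chi2_pdf d t.

(* The inverse F^-1 : [0, 1) -> [0, +oo) of the chi^2(d) distribution function
   (d >= 1). Restricting to the support 0 <= x matters only at p = 0, where it
   gives F^-1(0) = 0. *)
Definition chi2_quantile (d : nat) (p : R) : R :=
  inf [set x | 0 <= x /\ p <= chi2_cdf d x].

End Chi2.

Section AndersonRubin.
Context {R : realType}.

Definition qform p (M : 'M[R]_p) (u : 'cV[R]_p) : R := (u^T *m M *m u) 0 0.

(* Squared Euclidean norm; the library norm on matrices is the sup norm. *)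
Definition sqnorm p (u : 'cV[R]_p) : R := \sum_i u i 0 ^+ 2.

Definition proj n p (A : 'M[R]_(n, p)) : 'M[R]_n :=
  A *m pinv (A^T *m A) *m A^T.

Definition annih n p (A : 'M[R]_(n, p)) : 'M[R]_n := 1%:M - proj A.

(* Smallest real eigenvalue. It is applied below to a matrix C^-1 D with C
   symmetric positive definite and D symmetric, whose spectrum is real. *)
Definition lambda_min p (A : 'M[R]_p) : R := inf [set a | eigenvalue A a].

(* The minimum over gamma need not be attained when mw > 0, so it is rendered as
   an infimum. It runs over the gamma at which the ratio is defined: x / 0 = 0
   would otherwise turn a vanishing denominator into a spurious minimum. If there
   is no such gamma, the value is +oo. *)
Definition AR n k mx mw (y : 'cV[R]_n) (X : 'M[R]_(n, mx)) (W : 'M[R]_(n, mw))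
    (Z : 'M[R]_(n, k)) (beta : 'cV[R]_mx) : \bar R :=
  ereal_inf
    [set ((n%:R - k%:R) / (k%:R - mw%:R)
            * (qform (proj Z) (y - X *m beta - W *m gamma)
               / qform (annih Z) (y - X *m beta - W *m gamma)))%:E
      | gamma in [set gamma : 'cV[R]_mw |
                   qform (annih Z) (y - X *m beta - W *m gamma) != 0]].

Definition AR_full n k m (y : 'cV[R]_n) (S : 'M[R]_(n, m)) (Z : 'M[R]_(n, k))
    (b : 'cV[R]_m) : R :=
  (n%:R - k%:R) / k%:R
    * (qform (proj Z) (y - S *m b) / qform (annih Z) (y - S *m b)).

Definition CI_AR n k mx mw (y : 'cV[R]_n) (X : 'M[R]_(n, mx))
    (W : 'M[R]_(n, mw)) (Z : 'M[R]_(n, k)) (alpha : R) : set 'cV[R]_mx :=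
  [set beta | ((k%:R - mw%:R)%:E * AR y X W Z beta
                <= (chi2_quantile (k - mw) (1 - alpha))%:E)%E].

Definition kmat n k (Z : 'M[R]_(n, k)) (kappa : R) : 'M[R]_n :=
  1%:M - kappa *: annih Z.

Definition kclass n k m (y : 'cV[R]_n) (S : 'M[R]_(n, m)) (Z : 'M[R]_(n, k))
    (kappa : R) : 'cV[R]_m :=
  pinv (S^T *m kmat Z kappa *m S) *m (S^T *m kmat Z kappa *m y).

Definition selmx mx mw : 'M[R]_(mx, mx + mw) :=
  \matrix_(i, j) ((i : nat) == j)%:R.

Definition kappa_AR (n k mw : nat) (alpha : R) : R :=
  1 + chi2_quantile (k - mw) (1 - alpha) / (n%:R - k%:R).

Definition sigma2_hat n k m (y : 'cV[R]_n) (S : 'M[R]_(n, m))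
    (Z : 'M[R]_(n, k)) (kappa : R) : R :=
  (n%:R - k%:R)^-1 * sqnorm (annih Z *m (y - S *m kclass y S Z kappa)).

Definition Amx n k mx mw (X : 'M[R]_(n, mx)) (W : 'M[R]_(n, mw))
    (Z : 'M[R]_(n, k)) (kappa : R) : 'M[R]_mx :=
  let S := row_mx X W in
  let B := selmx mx mw in
  invmx (B *m invmx (S^T *m kmat Z kappa *m S) *m B^T).

Definition kappa_max n k mw (W : 'M[R]_(n, mw)) (Z : 'M[R]_(n, k)) : \bar R :=
  if (0 < mw)%N then
    (lambda_min (invmx (W^T *m annih Z *m W) *m (W^T *m proj Z *m W)) + 1)%:E
  else +oo%E.

End AndersonRubin.

(* Main.v *)
Require Import Defs.
From HB Require Import structures.
From mathcomp Require Import all_boot all_order all_algebra.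
From mathcomp Require Import all_classical all_reals all_analysis.
From mathcomp Require Import ring lra.
Import Defs.

Set Implicit Arguments.
Unset Strict Implicit.
Unset Printing Implicit Defensive.

Import Order.TTheory GRing.Theory Num.Theory.

Local Open Scope classical_set_scope.
Local Open Scope ring_scope.

(** Write [r] for the residual [y - X *m beta - W *m gam], [P] and [M] for
[proj Z] and [annih Z], and [lam] for [kappa - 1]. Since [P + M] is the
identity, [kmat Z kappa = P - lam *: M], so the form [f r = qform (kmat Z
kappa) r] is the numerator of the ratio [qform P r / qform M r] minus [lam]
times its denominator. The constant factors of the Anderson-Rubin statistic are
absorbed by [lam = chi2_quantile (k - mw) (1 - alpha) / (n%:R - k%:R)], and the
point [beta] lies in the confidence set iff the infimum over [gam] of the ratio
is at most [lam] ([CI_ARP]), and up to boundary effects this says that [f]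
takes a value at most 0 as [gam] varies.

The second-order part of [f] in [gam] is the form of [H = W^T *m kmat Z kappa
*m W = W^T *m P *m W - lam *: (W^T *m M *m W)]. By the variational description
of the smallest generalized eigenvalue ([lambda_min_pencil]), [H] is positive
semidefinite when [kappa <= kappa_max] and takes a negative value otherwise. In
the latter case [f] tends to minus infinity along a line of [gam]s, so every
[beta] belongs to the set.

When [kappa <= kappa_max], the k-class estimator is the critical point of the
quadratic [f] in [(beta, gam)] ([qform_kclass]), and completing the square in
[gam] leaves the Schur complement [Amx] as the quadratic part in [beta]
([qform_kmat_concentrate]). The minimum of [f] over [gam] is therefore [f (y -
S *m betahat) + qform Amx (beta - B *m betahat)], and [sigma2_hat_AR_full]
identifies the right-hand side of the announced inequality with [- f (y - S *m
betahat)].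

Two boundary effects remain, the infimum being possibly not attained and the
denominator possibly zero. If the minimum of [f] is positive, positive
definiteness of [H] makes [f] at least a fixed positive multiple of the
denominator ([annih_dominated]), so the ratio stays away from [lam]. If the
minimum is at most 0 and the denominator vanishes at the minimizer, then so
does the numerator, the fit is exact there, and [betahat] also fits exactly,
contrary to the assumption that its denominator is nonzero. *)

(** * Quadratic forms *)

Definition possemidef (R : realType) p (M : 'M[R]_p) : Prop :=
  forall u, 0 <= qform M u.

Lemma qform_mulmx (R : realType) p r (M : 'M[R]_p) (A : 'M[R]_(p, r)) u :
  qform M (A *m u) = qform (A^T *m M *m A) u.
Proof. by rewrite /qform trmx_mul !mulmxA. Qed.

Lemma qform0 (R : realType) p (M : 'M[R]_p) : qform M 0 = 0.
Proof. by rewrite /qform mulmx0 mxE. Qed.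

Lemma qformZ (R : realType) p (M : 'M[R]_p) a u :
  qform M (a *: u) = a ^+ 2 * qform M u.
Proof.
have tZ : (a *: u)^T = a *: u^T by exact: linearZ.
rewrite /qform -scalemxAr mxE tZ.
by rewrite -!scalemxAl mxE expr2 mulrA.
Qed.

Lemma qformN (R : realType) p (M : 'M[R]_p) u : qform M (- u) = qform M u.
Proof. by rewrite -scaleN1r qformZ sqrrN expr1n mul1r. Qed.

Lemma qformBmx (R : realType) p (M N : 'M[R]_p) u :
  qform (M - N) u = qform M u - qform N u.
Proof. by rewrite /qform mulmxBr mulmxBl !mxE. Qed.

Lemma qformZmx (R : realType) p (M : 'M[R]_p) a u :
  qform (a *: M) u = a * qform M u.
Proof. by rewrite /qform -scalemxAr -scalemxAl mxE. Qed.

Lemma qformD (R : realType) p (M : 'M[R]_p) u v : M^T = M ->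
  qform M (u + v) = qform M u + 2 * (u^T *m (M *m v)) 0 0 + qform M v.
Proof.
move=> sM; have tD : (u + v)^T = u^T + v^T by exact: raddfD.
have eD (A B : 'M[R]_1) : (A + B) 0 0 = A 0 0 + B 0 0 by rewrite mxE.
rewrite /qform tD !(mulmxDl, mulmxDr) !eD.
have -> : (v^T *m M *m u) 0 0 = (u^T *m M *m v) 0 0.
  by rewrite -[in LHS](trmxK u) -[in LHS]sM -trmx_mul -trmx_mul mxE mulmxA.
by rewrite mulmxA; ring.
Qed.

Lemma qform_sqnorm (R : realType) p (M : 'M[R]_p) u :
  M^T = M -> M *m M = M -> qform M u = sqnorm (M *m u).
Proof.
move=> sM iM; rewrite /qform -{1}iM mulmxA -mulmxA -{1}sM -trmx_mul /sqnorm mxE.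
by apply: eq_bigr => i _; rewrite mxE expr2.
Qed.

Lemma possemidef_idem (R : realType) p (M : 'M[R]_p) :
  M^T = M -> M *m M = M -> possemidef M.
Proof.
move=> sM iM u; rewrite qform_sqnorm//.
by apply: sumr_ge0 => i _; exact: sqr_ge0.
Qed.

Lemma possemidef_congr (R : realType) p r (M : 'M[R]_p) (A : 'M[R]_(p, r)) :
  possemidef M -> possemidef (A^T *m M *m A).
Proof. by move=> pM u; rewrite -qform_mulmx. Qed.

Lemma sym_congr (R : realType) p r (M : 'M[R]_p) (A : 'M[R]_(p, r)) :
  M^T = M -> (A^T *m M *m A)^T = A^T *m M *m A.
Proof. by move=> sM; rewrite !trmx_mul trmxK sM mulmxA. Qed.

(** The parallelogram identity, with the form of the sum of the two vectors
dropped. *)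
Lemma qformB_le (R : realType) p (M : 'M[R]_p) u v : M^T = M -> possemidef M ->
  qform M (u - v) <= 2 * qform M u + 2 * qform M v.
Proof.
move=> sM pM; have := pM (u + v).
by rewrite !qformD// qformN mulmxN mulmxN [in X in _ -> X]mxE; lra.
Qed.

(** A coordinate [u i] is [w^T *m H *m u] for [w] the [i]-th column of the
inverse of [H], so positivity of the form of [H] at [u - t *: w] for a
suitable [t] bounds it. *)
Lemma coord_le_qform (R : realType) p (H : 'M[R]_p) i :
  H^T = H -> possemidef H -> H \in unitmx ->
  exists2 g, 0 <= g & forall u : 'cV_p, u i 0 ^+ 2 <= g * qform H u.
Proof.
move=> sH pH uH; pose w := invmx H *m (delta_mx i 0 : 'cV_p).
pose g := 1 + qform H w; have g0 : 0 < g by rewrite /g; have := pH w; lra.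
exists g => [|u]; first exact: ltW.
have Hw : (u^T *m (H *m w)) 0 0 = u i 0.
  rewrite /w (mulmxA H) mulmxV// mul1mx !mxE (bigD1 i)//= big1 => [|j /negPf ji].
    by rewrite !mxE !eqxx mulr1 addr0.
  by rewrite !mxE ji mulr0.
(* This multiple nearly minimizes the form along the line through [u] directed
   by [w]; the shift by 1 in [g] avoids a division by zero. *)
have := pH (u + (- (u i 0 / g)) *: w).
rewrite qformD// qformZ -scalemxAr -scalemxAr mxE Hw => h.
have {h} : 0 <= g * (qform H u + 2 * (- (u i 0 / g) * u i 0)
    + (- (u i 0 / g)) ^+ 2 * qform H w) by rewrite mulr_ge0// ltW.
rewrite (_ : g * _ = g * qform H u - u i 0 ^+ 2 - u i 0 ^+ 2 / g).
  by have := divr_ge0 (sqr_ge0 (u i 0)) (ltW g0); lra.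
have -> : qform H w = g - 1 by rewrite /g; ring.
by field; rewrite gt_eqF.
Qed.

(** A positive semidefinite invertible form is positive definite, hence
dominates every other form: this replaces the compactness of the sphere. *)
Lemma qform_dominated (R : realType) p (H C : 'M[R]_p) :
  H^T = H -> possemidef H -> H \in unitmx ->
  exists2 c, 0 < c & forall u : 'cV_p, qform C u <= c * qform H u.
Proof.
move=> sH pH uH.
have /choice[g hg] : forall i, exists g,
    0 <= g /\ forall u : 'cV_p, u i 0 ^+ 2 <= g * qform H u.
  by move=> i; have [g] := coord_le_qform i sH pH uH; exists g.
pose c := \sum_i \sum_j `|C j i| * (g i + g j).
have c0 : 0 <= c.
  apply: sumr_ge0 => i _; apply: sumr_ge0 => j _; apply: mulr_ge0 => //.
  by apply: addr_ge0; have [] := hg i; have [] := hg j.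
(* The summand 1 only makes the constant positive. *)
exists (c + 1) => [|u]; first lra.
suff h : qform C u <= c * qform H u by have := pH u; nra.
rewrite /qform mxE /c mulr_suml; apply: ler_sum => i _.
rewrite mxE !mulr_suml; apply: ler_sum => j _; rewrite mxE.
rewrite (le_trans (ler_norm _))// !normrM -mulrA mulrCA -mulrA ler_wpM2l//.
have [_ /(_ u)] := hg i; have [_ /(_ u)] := hg j.
rewrite -/(qform H u) -[u i 0 ^+ 2]real_normK ?num_real//.
rewrite -[u j 0 ^+ 2]real_normK ?num_real// => hj hi.
have := sqr_ge0 (`|u i 0| - `|u j 0|).
have := sqr_ge0 (`|u i 0| + `|u j 0|); nra.
Qed.

Lemma qform_gt0 (R : realType) p (H : 'M[R]_p) u :
  H^T = H -> possemidef H -> H \in unitmx -> u != 0 -> 0 < qform H u.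
Proof.
move=> sH pH uH; rewrite lt_neqAle pH andbT; apply: contraNN => /eqP Hu0.
apply/eqP/matrixP => i j; rewrite ord1 mxE.
have [g _ /(_ u)] := coord_le_qform i sH pH uH.
by rewrite -Hu0 mulr0 => h; apply/eqP; rewrite -sqrf_eq0 eq_le h sqr_ge0.
Qed.

Lemma quadratic_lt0 (R : realType) (a b h : R) : h < 0 ->
  exists t, a + t * b + t ^+ 2 * h < 0.
Proof.
move=> h0; pose s := `|a| + `|b|.
have s0 : 0 <= s by rewrite addr_ge0.
(* As [t >= 1], it suffices that [t * h] is below [- (`|a| + `|b|)]. *)
exists (1 - s / h); set t := 1 - s / h.
have t1 : 1 <= t by rewrite /t lerDl oppr_ge0 mulr_ge0_le0// invr_le0 ltW.
have th : t * h = h - s by rewrite /t; field; rewrite lt_eqF.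
have := ler_norm a; have := ler_norm b; have := normr_ge0 a.
by rewrite expr2 -mulrA th /s; nra.
Qed.

(** * The smallest eigenvalue of a symmetric definite pencil *)

Lemma eigenvalue_pencil (R : realType) p (C D : 'M[R]_p) a :
  C^T = C -> D^T = D -> C \in unitmx ->
  eigenvalue (invmx C *m D) a <->
  exists2 u : 'cV_p, u != 0 & D *m u = a *: (C *m u).
Proof.
move=> sC sD uC; split=> [/eigenvalueP[v vE v0]|[u u0 uE]].
  exists (v *m invmx C)^T.
    apply: contraNneq v0 => /(congr1 trmx); rewrite trmxK trmx0 => h.
    by rewrite -[v](mulmxKV uC) h mul0mx.
  rewrite -{1}sD -{2}sC -!trmx_mul -mulmxA vE mulmxKV//.
  by rewrite linearZ.
apply/eigenvalueP; exists (u^T *m C).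
  by rewrite mulmxA mulmxK// -{1}sD -{1}sC -!trmx_mul uE linearZ.
apply: contraNneq u0 => h; rewrite -[u]trmxK -[u^T](mulmxK uC) h.
by rewrite mul0mx trmx0.
Qed.

(** The largest [a] for which [D - a *: C] is positive semidefinite. At this
[a] the form cannot be invertible, as it would then dominate [C] and leave room
to increase [a]; so [a] is an eigenvalue, and semidefiniteness makes it a lower
bound for all the others. *)
Lemma lambda_min_pencil (R : realType) p (C D : 'M[R]_p) :
  (0 < p)%N -> C^T = C -> possemidef C -> C \in unitmx ->
  D^T = D -> possemidef D ->
  possemidef (D - lambda_min (invmx C *m D) *: C) /\
  exists2 u : 'cV_p, u != 0 &
    qform (D - lambda_min (invmx C *m D) *: C) u = 0.
Proof.
move=> p0 sC pC uC sD pD.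
have qE a u : qform (D - a *: C) u = qform D u - a * qform C u.
  by rewrite qformBmx qformZmx.
pose E := [set a | possemidef (D - a *: C)]; pose a0 := sup E.
have E0 : E 0 by move=> u; rewrite qE mul0r subr0.
have ubE u : u != 0 -> ubound E (qform D u / qform C u).
  move=> u0 a /(_ u); rewrite qE subr_ge0 ler_pdivlMr//.
  exact: qform_gt0.
have hE : has_ubound E.
  pose u : 'cV[R]_p := const_mx 1; exists (qform D u / qform C u).
  apply: ubE; apply/eqP => /matrixP /(_ (Ordinal p0) 0).
  by rewrite !mxE => /eqP; rewrite oner_eq0.
have Ea0 : E a0.
  move=> u; rewrite qE subr_ge0.
  have [->|u0] := eqVneq u 0; first by rewrite !qform0 mulr0.
  rewrite -ler_pdivlMr; last exact: qform_gt0.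
  by apply: ge_sup (ubE u u0); exists 0.
have sDa : (D - a0 *: C)^T = D - a0 *: C by rewrite linearB linearZ /= sC sD.
have nuDa : D - a0 *: C \notin unitmx.
  apply/negP => uDa; have [c c0 hc] := qform_dominated C sDa Ea0 uDa.
  have : E (a0 + c^-1).
    move=> u; have := hc u; rewrite -ler_pdivrMl// !qE; lra.
  move=> /(ub_le_sup hE); rewrite -/a0 gerDl.
  by rewrite leNgt invr_gt0 c0.
have [u u0 uE] : exists2 u : 'cV_p, u != 0 & (D - a0 *: C) *m u = 0.
  apply: contrapT => nex; move/negP: nuDa; apply.
  rewrite -unitmx_tr -row_free_unit; apply/inj_row_free => v vE.
  apply/eqP/negPn/negP => v0; apply: nex; exists v^T.
    by apply: contraNneq v0 => h; rewrite -[v]trmxK h trmx0.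
  by rewrite -{1}[D - _]trmxK -trmx_mul vE trmx0.
have eig0 : eigenvalue (invmx C *m D) a0.
  rewrite eigenvalue_pencil//; exists u => //.
  by apply/eqP; rewrite -subr_eq0 scalemxAl -mulmxBl uE.
have lb0 : lbound [set a | eigenvalue (invmx C *m D) a] a0.
  move=> a; rewrite /= eigenvalue_pencil// => -[v v0 vE].
  have := Ea0 v; rewrite qE /qform -!mulmxA vE -scalemxAr mxE.
  rewrite mulmxA -/(qform C v) -mulrBl.
  by rewrite pmulr_lge0 ?subr_ge0//; exact: qform_gt0.
have -> : lambda_min (invmx C *m D) = a0.
  apply/le_anti/andP; split; first by apply: ge_inf => //; exists a0.
  by apply: lb_le_inf => //; exists a0.
split=> //; exists u => //.
by rewrite /qform -mulmxA uE mulmx0 mxE.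
Qed.

(** * Orthogonal projections *)

Lemma moore_penrose_tr (R : realType) p (A G : 'M[R]_p) : A^T = A ->
  moore_penrose A G -> moore_penrose A G^T.
Proof.
move=> sA [AGA GAG AG GA]; split.
- by rewrite -{1 2}sA -!trmx_mul mulmxA AGA.
- by rewrite -sA -!trmx_mul mulmxA GAG.
- by rewrite -sA -trmx_mul trmxK GA.
- by rewrite -sA -trmx_mul trmxK AG.
Qed.

Lemma pinv_sym (R : realType) p (A : 'M[R]_p) : A^T = A -> (pinv A)^T = pinv A.
Proof.
move=> sA; apply: (@moore_penrose_uniq _ _ _ A); last exact: pinvP.
by apply: moore_penrose_tr (pinvP A).
Qed.

Lemma pinv_unit (R : realType) p (A : 'M[R]_p) :
  A \in unitmx -> pinv A = invmx A.
Proof.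
move=> uA; apply: (@moore_penrose_uniq _ _ _ A); first exact: pinvP.
by split; rewrite ?mulmxV ?mulVmx ?mul1mx ?trmx1.
Qed.

Lemma proj_sym (R : realType) n p (A : 'M[R]_(n, p)) : (proj A)^T = proj A.
Proof.
rewrite /proj !trmx_mul trmxK pinv_sym ?mulmxA//.
by rewrite trmx_mul trmxK.
Qed.

Lemma proj_idem (R : realType) n p (A : 'M[R]_(n, p)) :
  proj A *m proj A = proj A.
Proof.
rewrite /proj; have [_ GAG _ _] := pinvP (A^T *m A).
by rewrite -[in RHS]GAG !mulmxA.
Qed.

Lemma annih_sym (R : realType) n p (A : 'M[R]_(n, p)) : (annih A)^T = annih A.
Proof. by rewrite /annih linearB /= trmx1 proj_sym. Qed.

Lemma annih_idem (R : realType) n p (A : 'M[R]_(n, p)) :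
  annih A *m annih A = annih A.
Proof.
by rewrite /annih mulmxBl mul1mx mulmxBr mulmx1 proj_idem subrr subr0.
Qed.

Lemma proj_ge0 (R : realType) n p (A : 'M[R]_(n, p)) : possemidef (proj A).
Proof. by apply: possemidef_idem; [exact: proj_sym|exact: proj_idem]. Qed.

Lemma annih_ge0 (R : realType) n p (A : 'M[R]_(n, p)) : possemidef (annih A).
Proof. by apply: possemidef_idem; [exact: annih_sym|exact: annih_idem]. Qed.

Lemma kmatE (R : realType) n p (A : 'M[R]_(n, p)) kap :
  kmat A kap = proj A - (kap - 1) *: annih A.
Proof.
have {1}-> : proj A = 1%:M - annih A by rewrite /annih opprB addrC subrK.
by rewrite /kmat scalerBl scale1r (opprB (_ *: _)) addrA subrK.
Qed.

Lemma kmat_sym (R : realType) n p (A : 'M[R]_(n, p)) kap :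
  (kmat A kap)^T = kmat A kap.
Proof. by rewrite /kmat linearB linearZ /= trmx1 annih_sym. Qed.

Lemma qform_kmat (R : realType) n p (A : 'M[R]_(n, p)) kap u :
  qform (kmat A kap) u = qform (proj A) u - (kap - 1) * qform (annih A) u.
Proof. by rewrite kmatE qformBmx qformZmx. Qed.

(** As the two projections add up to the identity, a vector on which both forms
vanish is zero. *)
Lemma qform_proj_annih_eq0 (R : realType) n p (A : 'M[R]_(n, p)) u :
  qform (proj A) u = 0 -> qform (annih A) u = 0 -> u = 0.
Proof.
move=> Pu Mu; have : qform 1%:M u = 0.
  rewrite (_ : 1%:M = proj A - (-1) *: annih A); last first.
    by rewrite scaleN1r opprK /annih addrC subrK.
  by rewrite qformBmx qformZmx Pu Mu mulr0 subr0.
rewrite /qform mulmx1 => h.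
by apply: gram_eq0; rewrite [LHS]mx11_scalar h raddf0.
Qed.

(** * Schur complements *)

(** Block elimination: the second block row of [G *m invmx G = 1] expresses the
lower left block of the inverse through the upper left one, and the first row
then says that the latter inverts the Schur complement. *)
Lemma schur_ul_inv (R : realType) p r (G11 : 'M[R]_p) (G12 : 'M[R]_(p, r))
    (G21 : 'M[R]_(r, p)) (H : 'M[R]_r) :
  let G := block_mx G11 G12 G21 H in
  G \in unitmx -> H \in unitmx ->
  (G11 - G12 *m invmx H *m G21) *m ulsubmx (invmx G) = 1%:M.
Proof.
move=> G uG uH; have := mulmxV uG; rewrite -[invmx G]submxK.
rewrite (mulmx_block G11 G12 G21 H) scalar_mx_block submxK => /eq_block_mx[e1 _ e2 _].
have -> : (G11 - G12 *m invmx H *m G21) *m ulsubmx (invmx G) =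
    G11 *m ulsubmx (invmx G)
    - G12 *m (invmx H *m (G21 *m ulsubmx (invmx G))).
  by rewrite mulmxBl !mulmxA.
by rewrite -2!mulmxN (addr0_eq e2) mulKmx.
Qed.

(** Completing the square in the second block of coordinates. *)
Lemma schur_square (R : realType) p r (G11 : 'M[R]_p) (G21 : 'M[R]_(r, p))
    (H : 'M[R]_r) (u : 'cV_p) (v : 'cV_r) :
  H^T = H -> H \in unitmx ->
  qform (block_mx G11 G21^T G21 H) (col_mx u v) =
  qform (G11 - G21^T *m invmx H *m G21) u + qform H (v + invmx H *m G21 *m u).
Proof.
move=> sH uH; rewrite qformBmx (qformD _ _ sH) qform_mulmx.
rewrite [(invmx H *m G21)^T]trmx_mul trmx_inv sH.
rewrite -(mulmxA _ (invmx H) H) mulVmx// mulmx1 (mulmxA _ (invmx H) G21).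
rewrite (mulmxA H (invmx H *m G21)) (mulmxA H) mulmxV// mul1mx.
rewrite /qform tr_col_mx mul_row_block mul_row_col !mulmxDl.
have eD (A B : 'M[R]_1) : (A + B) 0 0 = A 0 0 + B 0 0 by rewrite mxE.
rewrite !eD.
have -> : (u^T *m G21^T *m v) 0 0 = (v^T *m (G21 *m u)) 0 0.
  transitivity ((v^T *m (G21 *m u))^T 0 0); last by rewrite mxE.
  by rewrite !trmx_mul trmxK.
by rewrite -(mulmxA v^T G21); ring.
Qed.

Lemma selmxE (R : realType) p r : selmx p r = row_mx 1%:M 0 :> 'M[R]_(p, p + r).
Proof.
apply/matrixP => i j; rewrite !mxE; case: splitP => l jl; rewrite !mxE jl //.
by rewrite ltn_eqF// ltn_addr.
Qed.

Lemma selmx_col (R : realType) p r (u : 'cV[R]_p) (v : 'cV[R]_r) :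
  selmx p r *m col_mx u v = u.
Proof. by rewrite selmxE mul_row_col mul1mx mul0mx addr0. Qed.

Lemma selmx_ulsubmx (R : realType) p r (G : 'M[R]_(p + r)) :
  selmx p r *m G *m (selmx p r)^T = ulsubmx G.
Proof.
rewrite -{1}[G]submxK selmxE tr_row_mx trmx1 trmx0 mul_row_block !mul1mx !mul0mx.
by rewrite !addr0 mul_row_col mulmx1 mulmx0 addr0.
Qed.

(** * The k-class estimator and the concentrated quadratic *)

Lemma gram_row_mx (R : realType) n p r (K : 'M[R]_n) (X : 'M[R]_(n, p))
    (W : 'M[R]_(n, r)) : K^T = K ->
  (row_mx X W)^T *m K *m row_mx X W =
  block_mx (X^T *m K *m X) (W^T *m K *m X)^T (W^T *m K *m X) (W^T *m K *m W).
Proof.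
move=> sK; rewrite tr_row_mx mul_col_mx mul_col_row; congr block_mx.
by rewrite !trmx_mul trmxK sK mulmxA.
Qed.

Lemma Amx_schur (R : realType) n k mx mw (X : 'M[R]_(n, mx))
    (W : 'M[R]_(n, mw)) (Z : 'M[R]_(n, k)) kap :
  let S := row_mx X W in
  let B := selmx mx mw in
  let K := kmat Z kap in
  S^T *m K *m S \in unitmx -> W^T *m K *m W \in unitmx ->
  B *m invmx (S^T *m K *m S) *m B^T \in unitmx /\
  Amx X W Z kap =
    X^T *m K *m X - (W^T *m K *m X)^T *m invmx (W^T *m K *m W) *m (W^T *m K *m X).
Proof.
move=> S B K uG uH; rewrite /Amx selmx_ulsubmx.
move: uG; rewrite /S gram_row_mx ?kmat_sym// => uG.
have TQ := schur_ul_inv uG uH; have [_ uQ] := mulmx1_unit TQ.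
by split=> //; rewrite -[LHS]mul1mx -TQ mulmxK.
Qed.

(** [kclass] solves the normal equations of the form of [kmat Z kap], so the
cross term vanishes in the expansion of that form around it. *)
Lemma qform_kclass (R : realType) n k m (y : 'cV[R]_n) (S : 'M[R]_(n, m))
    (Z : 'M[R]_(n, k)) kap c :
  let b := kclass y S Z kap in
  S^T *m kmat Z kap *m S \in unitmx ->
  qform (kmat Z kap) (y - S *m c) =
  qform (kmat Z kap) (y - S *m b) + qform (S^T *m kmat Z kap *m S) (c - b).
Proof.
move=> b uG.
have -> : y - S *m c = - (S *m (c - b)) + (y - S *m b).
  by rewrite mulmxBr opprB [RHS]addrC addrA subrK.
rewrite [LHS]qformD ?kmat_sym// qformN [qform _ (S *m (c - b))]qform_mulmx.
have -> : (- (S *m (c - b)))^T *m (kmat Z kap *m (y - S *m b)) = 0.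
  rewrite linearN /= trmx_mul mulNmx -mulmxA (mulmxA S^T) mulmxBr.
  rewrite (mulmxA _ S b) /b /kclass pinv_unit// mulKVmx//.
  by rewrite subrr mulmx0 oppr0.
by rewrite mxE; ring.
Qed.

(** Here [gopt] minimizes over [gam] at fixed [beta] as soon as the form of
[W^T *m kmat Z kap *m W] is positive semidefinite. *)
Lemma qform_kmat_concentrate (R : realType) n k mx mw (y : 'cV[R]_n)
    (X : 'M[R]_(n, mx)) (W : 'M[R]_(n, mw)) (Z : 'M[R]_(n, k)) kap beta :
  let S := row_mx X W in
  let b := kclass y S Z kap in
  S^T *m kmat Z kap *m S \in unitmx -> W^T *m kmat Z kap *m W \in unitmx ->
  exists gopt : 'cV_mw, forall gam,
    qform (kmat Z kap) (y - X *m beta - W *m gam) =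
    qform (kmat Z kap) (y - S *m b)
    + qform (Amx X W Z kap) (beta - selmx mx mw *m b)
    + qform (W^T *m kmat Z kap *m W) (gam - gopt).
Proof.
move=> S b uG uH; have [_ ->] := Amx_schur uG uH.
set K := kmat Z kap; set H := W^T *m K *m W; set G21 := W^T *m K *m X.
have sK : K^T = K by exact: kmat_sym.
exists (dsubmx b - invmx H *m G21 *m (beta - usubmx b)) => gam.
have -> : selmx mx mw *m b = usubmx b by rewrite -{1}[b]vsubmxK selmx_col.
have -> : y - X *m beta - W *m gam = y - S *m col_mx beta gam.
  by rewrite /S mul_row_col opprD addrA.
rewrite qform_kclass// -/b -addrA; congr (_ + _).
have -> : col_mx beta gam - b = col_mx (beta - usubmx b) (gam - dsubmx b).
  by rewrite -{1}[b]vsubmxK opp_col_mx add_col_mx.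
rewrite /S gram_row_mx// schur_square//; last exact: sym_congr.
by congr (_ + qform _ _); rewrite opprB [in RHS]addrA addrAC.
Qed.

(** * Definiteness below and above kappa_max *)

Lemma gram_kmat (R : realType) n k mw (W : 'M[R]_(n, mw)) (Z : 'M[R]_(n, k)) kap :
  W^T *m kmat Z kap *m W =
  W^T *m proj Z *m W - (kap - 1) *: (W^T *m annih Z *m W).
Proof. by rewrite kmatE mulmxBr mulmxBl -scalemxAr -scalemxAl. Qed.

Lemma possemidef_le_kappa_max (R : realType) n k mw (W : 'M[R]_(n, mw))
    (Z : 'M[R]_(n, k)) kap : W^T *m annih Z *m W \in unitmx ->
  (kap%:E <= kappa_max W Z)%E -> possemidef (W^T *m kmat Z kap *m W).
Proof.
move=> uC; rewrite /kappa_max; case: ifPn => [mw0|]; last first.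
  rewrite -leqNgt leqn0 => /eqP mw0 _ u.
  suff -> : u = 0 by rewrite qform0.
  by apply/matrixP => i; have : (i < 0)%N by rewrite -[X in (_ < X)%N]mw0.
have [pD _] := lambda_min_pencil mw0 (sym_congr W (annih_sym Z))
  (possemidef_congr W (annih_ge0 Z)) uC (sym_congr W (proj_sym Z))
  (possemidef_congr W (proj_ge0 Z)).
rewrite lee_fin -lerBlDr => le_kap u; apply: le_trans (pD u) _.
rewrite gram_kmat !qformBmx !qformZmx lerB// ler_wpM2r//.
exact: possemidef_congr W (annih_ge0 Z) u.
Qed.

Lemma neg_direction_gt_kappa_max (R : realType) n k mw (W : 'M[R]_(n, mw))
    (Z : 'M[R]_(n, k)) kap : W^T *m annih Z *m W \in unitmx ->
  ~ (kap%:E <= kappa_max W Z)%E ->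
  exists u, qform (W^T *m kmat Z kap *m W) u < 0.
Proof.
move=> uC; rewrite /kappa_max; case: ifPn => [mw0|]; last by rewrite leey.
have sC := sym_congr W (annih_sym Z).
have pC := possemidef_congr W (annih_ge0 Z).
have [_ [u u0]] := lambda_min_pencil mw0 sC pC uC (sym_congr W (proj_sym Z))
  (possemidef_congr W (proj_ge0 Z)).
move=> + /negP; rewrite lee_fin -ltNge -ltrBrDr => Du lt_kap; exists u.
move: Du; rewrite gram_kmat !qformBmx !qformZmx => <-.
by rewrite ltrD2l ltrN2 ltr_pM2r//; exact: qform_gt0.
Qed.

(** * The Anderson-Rubin confidence set *)

(** The infimum is at most a level exactly when the ratio gets below every
larger level; multiplying out the denominator gives a polynomial condition. *)
Lemma CI_ARP (R : realType) n k mx mw (y : 'cV[R]_n) (X : 'M[R]_(n, mx))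
    (W : 'M[R]_(n, mw)) (Z : 'M[R]_(n, k)) alpha beta :
  (k < n)%N -> (mw < k)%N ->
  CI_AR y X W Z alpha beta <->
  forall e, 0 < e -> exists gam, let r := y - X *m beta - W *m gam in
    qform (annih Z) r != 0 /\
    qform (proj Z) r < (kappa_AR n k mw alpha - 1 + e) * qform (annih Z) r.
Proof.
move=> kn mwk; rewrite /CI_AR /kappa_AR /=; set q := chi2_quantile _ _.
have kmw0 : (0 : R) < k%:R - mw%:R by rewrite subr_gt0 ltr_nat.
have nk0 : (0 : R) < n%:R - k%:R by rewrite subr_gt0 ltr_nat.
rewrite -lee_pdivlMl// -EFinM; set N := qform (proj Z); set D := qform (annih Z).
pose c : R := (n%:R - k%:R) / (k%:R - mw%:R).
have c0 : 0 < c by rewrite divr_gt0.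
have lvl : (k%:R - mw%:R)^-1 * q = c * (q / (n%:R - k%:R)).
  by rewrite /c; field; rewrite !gt_eqF.
have lt_ratio r e : D r != 0 ->
    (c * (N r / D r) < (k%:R - mw%:R)^-1 * q + c * e) =
    (N r < (1 + q / (n%:R - k%:R) - 1 + e) * D r).
  move=> Dr; rewrite lvl -mulrDr ltr_pM2l// ltr_pdivrMr; last first.
    by rewrite lt_neqAle eq_sym Dr annih_ge0.
  by rewrite [1 + _]addrC addrK.
split=> [leq e e0|h].
  have : (AR y X W Z beta < ((k%:R - mw%:R)^-1 * q + c * e)%:E)%E.
    by apply: le_lt_trans leq _; rewrite lte_fin ltrDl mulr_gt0.
  move=> /ereal_inf_lt[_ [gam /= Dr <-]]; rewrite lte_fin lt_ratio// => Nr.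
  by exists gam.
apply/lee_addgt0Pr => e e0; have [|gam [Dr]] := h (e / c); first exact: divr_gt0.
rewrite -lt_ratio// [c * (e / c)]mulrC divfK ?gt_eqF// => Nr.
apply: le_trans (ereal_inf_lbound _) _; first by exists gam; [exact: Dr|reflexivity].
by rewrite -EFinD lee_fin ltW.
Qed.

(** [sigma2_hat] carries the denominator of [AR_full], so the product clears
it. The factor [(n%:R - k%:R) * (kap - 1)] is the chi-square quantile when
[kap] is [kappa_AR]. *)
Lemma sigma2_hat_AR_full (R : realType) n k m (y : 'cV[R]_n)
    (S : 'M[R]_(n, m)) (Z : 'M[R]_(n, k)) kap :
  let b := kclass y S Z kap in
  (0 < k)%N -> (k < n)%N -> qform (annih Z) (y - S *m b) != 0 ->
  sigma2_hat y S Z kap * ((n%:R - k%:R) * (kap - 1) - k%:R * AR_full y S Z b) =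
  - qform (kmat Z kap) (y - S *m b).
Proof.
move=> b k0 kn D0; rewrite /sigma2_hat -/b /AR_full.
rewrite -(qform_sqnorm _ (annih_sym Z) (annih_idem Z)) qform_kmat.
field; rewrite D0 pnatr_eq0 -lt0n k0.
by rewrite gt_eqF// subr_gt0 ltr_nat.
Qed.

(** Meant for [f0] the minimum over [gam] of the numerator minus [kap - 1]
times the denominator, and [gopt] the minimizer: if that minimum is positive,
the denominator is at most a multiple of the difference, its constant terms
being absorbed by [f0] and quadratic ones by the positive definite [H]. *)
Lemma annih_dominated (R : realType) n k mw (Z : 'M[R]_(n, k))
    (W : 'M[R]_(n, mw)) kap (r0 : 'cV[R]_n) gopt f0 :
  let H := W^T *m kmat Z kap *m W in
  possemidef H -> H \in unitmx -> 0 < f0 ->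
  exists2 c, 0 < c & forall gam, qform (annih Z) (r0 - W *m gam) <=
    c * (f0 + qform H (gam - gopt)).
Proof.
move=> H pH uH f00.
have [c c0 hc] := qform_dominated (W^T *m annih Z *m W)
  (sym_congr W (kmat_sym Z kap)) pH uH.
pose D0 := qform (annih Z) (r0 - W *m gopt).
have D00 : 0 <= D0 by exact: annih_ge0.
exists (2 * D0 / f0 + 2 * c) => [|gam].
  by rewrite ltr_wpDl ?mulr_gt0// divr_ge0 ?mulr_ge0// ltW.
have -> : r0 - W *m gam = (r0 - W *m gopt) - W *m (gam - gopt).
  by rewrite mulmxBr opprB addrA subrK.
apply: le_trans (qformB_le _ _ (annih_sym Z) (annih_ge0 Z)) _.
rewrite -/D0 qform_mulmx; have := hc (gam - gopt).
have := pH (gam - gopt); set h := qform H _ => h0 le_c.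
have -> : (2 * D0 / f0 + 2 * c) * (f0 + h) =
    2 * D0 + 2 * (c * h) + (2 * D0 / f0 * h + 2 * c * f0).
  by field; rewrite gt_eqF.
have : 0 <= 2 * D0 / f0 * h + 2 * c * f0.
  by rewrite addr_ge0 ?mulr_ge0 ?invr_ge0 ?(ltW f00) ?(ltW c0).
lra.
Qed.

(** * The confidence set as a quadric *)

Theorem proposition1 (R : realType) (n k mx mw : nat)
    (y : 'cV[R]_n) (X : 'M[R]_(n, mx)) (W : 'M[R]_(n, mw)) (Z : 'M[R]_(n, k))
    (alpha : R)
    (le_m_k : (mx + mw <= k)%N) (lt_k_n : (k < n)%N) (lt_mw_k : (mw < k)%N)
    (alpha_gt0 : 0 < alpha) (alpha_le1 : alpha <= 1)
    (WMW_unit : W^T *m annih Z *m W \in unitmx) :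
  let S := row_mx X W in
  let B := selmx mx mw in
  let q := chi2_quantile (k - mw) (1 - alpha) in
  let kappa := kappa_AR n k mw alpha in
  let betahat := kclass y S Z kappa in
  [/\ S *m B^T = X,
      forall kap : R,
        S^T *m kmat Z kap *m S \in unitmx ->
        W^T *m kmat Z kap *m W \in unitmx ->
        B *m invmx (S^T *m kmat Z kap *m S) *m B^T \in unitmx /\
        Amx X W Z kap =
          X^T *m kmat Z kap *m X
          - X^T *m kmat Z kap *m W *m invmx (W^T *m kmat Z kap *m W)
              *m (W^T *m kmat Z kap *m X),
      (kappa%:E <= kappa_max W Z)%E ->
        S^T *m kmat Z kappa *m S \in unitmx ->
        W^T *m kmat Z kappa *m W \in unitmx ->
        qform (annih Z) (y - S *m betahat) != 0 ->
        CI_AR y X W Z alpha =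
          [set beta : 'cV[R]_mx |
             qform (Amx X W Z kappa) (beta - B *m betahat)
             <= sigma2_hat y S Z kappa * (q - k%:R * AR_full y S Z betahat)] &
      ~ (kappa%:E <= kappa_max W Z)%E ->
        CI_AR y X W Z alpha = [set: 'cV[R]_mx]].
Proof.
move=> S B q kappa betahat; split.
- by rewrite /S /B selmxE tr_row_mx trmx1 trmx0 mul_row_col mulmx1 mulmx0 addr0.
- move=> kap uG uH; have [uB ->] := Amx_schur uG uH; split=> //.
  by rewrite !trmx_mul trmxK kmat_sym !mulmxA.
- move=> le_kap uG uH D0; have pH := possemidef_le_kappa_max WMW_unit le_kap.
  have nk0 : (n%:R - k%:R : R) != 0 by rewrite subr_eq0 eqr_nat gtn_eqF.
  have qE : q = (n%:R - k%:R) * (kappa - 1).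
    by rewrite /kappa /kappa_AR -/q; field.
  have k0 : (0 < k)%N by exact: leq_ltn_trans lt_mw_k.
  have -> : sigma2_hat y S Z kappa * (q - k%:R * AR_full y S Z betahat) =
      - qform (kmat Z kappa) (y - S *m betahat).
    by rewrite qE; exact: sigma2_hat_AR_full.
  apply/seteqP; split=> beta /=; rewrite CI_ARP// -/kappa.
    have [gopt fE] := qform_kmat_concentrate y beta uG uH.
    rewrite leNgt => h; apply/negP => lt_f0.
    have f0 : 0 < qform (kmat Z kappa) (y - S *m betahat)
        + qform (Amx X W Z kappa) (beta - B *m betahat) by lra.
    have [c c0 hc] := annih_dominated (y - X *m beta) gopt pH uH f0.
    have [|gam [Dr Nr]] := h c^-1; first by rewrite invr_gt0.
    have := hc gam; rewrite -fE -ler_pdivrMl// qform_kmat; lra.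
  have [gopt fE] := qform_kmat_concentrate y beta uG uH.
  move=> le_f0 e e0; exists gopt => r.
  have fr : qform (kmat Z kappa) r <= 0.
    by rewrite /r fE subrr qform0 addr0; lra.
  have D0' : qform (annih Z) r != 0.
    (* A vanishing denominator forces an exact fit, hence also at betahat. *)
    apply: contraNneq D0 => Dr; have Nr : qform (proj Z) r = 0.
      apply/le_anti; rewrite proj_ge0 andbT.
      by move: fr; rewrite qform_kmat Dr mulr0 subr0.
    have yE : y = S *m col_mx beta gopt.
      apply/eqP; rewrite /S mul_row_col -subr_eq0 opprD addrA.
      by apply/eqP; exact: qform_proj_annih_eq0 Nr Dr.
    have bE : betahat = col_mx beta gopt.
      by rewrite /betahat /kclass pinv_unit// {1}yE (mulmxA _ S) mulKmx.
    by rewrite bE -yE subrr qform0.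
  split=> //; have De : 0 < e * qform (annih Z) r.
    by rewrite mulr_gt0// lt_neqAle eq_sym D0' annih_ge0.
  move: fr; rewrite qform_kmat; lra.
- move=> gt_kap; have [u Hu] := neg_direction_gt_kappa_max WMW_unit gt_kap.
  apply/seteqP; split=> // beta _; rewrite CI_ARP// -/kappa => e e0.
  have [t ft] : exists t, qform (kmat Z kappa) (y - X *m beta - W *m (t *: u)) < 0.
    have [t ft] := quadratic_lt0 (qform (kmat Z kappa) (y - X *m beta))
      (2 * ((y - X *m beta)^T *m (kmat Z kappa *m - (W *m u))) 0 0) Hu.
    exists t; apply: le_lt_trans ft; rewrite -scalemxAr -scalerN.
    rewrite qformD ?kmat_sym// qformZ qformN qform_mulmx -!scalemxAr mxE.
    by rewrite mulrCA.
  exists (t *: u) => r; move: ft; rewrite -/r qform_kmat subr_lt0 => Nr.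
  have D0 : qform (annih Z) r != 0.
    by apply: contraTneq Nr => ->; rewrite mulr0 -leNgt proj_ge0.
  split=> //; apply: lt_le_trans Nr _.
  by rewrite ler_wpM2r ?annih_ge0// lerDl ltW.
Qed.
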